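(* Let $n\ge 6$ and let $\mathcal{G}=\{G_1,G_2,\ldots,G_n\}$ be a family of graphs on the same vertex set $[n]$ such that $\rho_S(G_i)>2n-4$ for every $i=1,\ldots,n$. Then $\mathcal{G}$ admits a rainbow Hamiltonian cycle, unless $G_1=G_2=\cdots=G_n\cong K_1\vee(K_{n-2}\cup K_1)$.
   Context: For a graph $G$, the signless Laplacian is $S(G)=D(G)+A(G)$ with $D(G)$ the diagonal degree matrix and $A(G)$ the adjacency matrix; $\rho_S(G)$ is the largest eigenvalue of $S(G)$. $K_1\vee(K_{n-2}\cup K_1)$ is $K_{n-1}$ plus one pendant vertex adjacent to one vertex of the $K_{n-1}$. $G_i=G_j$ means equal vertex and edge sets. A rainbow Hamiltonian cycle in $\mathcal{G}$ is a Hamiltonian cycle on the common vertex set whose $n$ edges can be labeled $e_1,\ldots,e_n$ with $e_i\in E(G_i)$ for each $i$. *)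

(* Defs.v *)
From HB Require Import structures.
From mathcomp Require Import all_boot all_order all_algebra all_fingroup.
From mathcomp Require Import reals.
Set Implicit Arguments. Unset Strict Implicit. Unset Printing Implicit Defensive.
Import Order.TTheory GRing.Theory Num.Theory.
Local Open Scope ring_scope.

Definition simple_graph (n : nat) (G : rel 'I_n) : Prop :=
  (forall x y, G x y = G y x) /\ (forall x, G x x = false).

Definition deg (n : nat) (G : rel 'I_n) (x : 'I_n) : nat := #|[set y | G x y]|.

Definition adj_mx (R : nzRingType) (n : nat) (G : rel 'I_n) : 'M[R]_n :=
  \matrix_(i, j) (G i j)%:R.
Definition deg_mx (R : nzRingType) (n : nat) (G : rel 'I_n) : 'M[R]_n :=
  \matrix_(i, j) ((i == j)%:R * (deg G i)%:R).
Definition signless_laplacian (R : nzRingType) (n : nat) (G : rel 'I_n) : 'M[R]_n :=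
  deg_mx R G + adj_mx R G.

Definition is_largest_eigenvalue (R : realFieldType) (n : nat) (A : 'M[R]_n) (r : R) : Prop :=
  eigenvalue A r /\ (forall a, eigenvalue A a -> a <= r).

(* K_1 \/ (K_{n-2} \cup K_1): vertices 0..n-2 form a clique K_{n-1},
   vertex n-1 is pendant, adjacent only to vertex 0. *)
Definition clique_pendant (n : nat) : rel 'I_n :=
  fun x y => (x != y) &&
    [|| ((x.+1 < n)%N && (y.+1 < n)%N),
        ((nat_of_ord x == 0)%N && (y.+1 == n)%N) |
        ((nat_of_ord y == 0)%N && (x.+1 == n)%N)].

Definition graph_iso (n : nat) (G H : rel 'I_n) : Prop :=
  exists s : {perm 'I_n}, forall x y, G x y = H (s x) (s y).

(* rainbow Hamiltonian cycle: the cycle v_0 v_1 ... v_{n-1} v_0 (v a bijection),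
   edge e_k = {v_k, v_{k+1 mod n}} is assigned to graph G_{c k}, c a bijection. *)
Definition rainbow_ham_cycle (n : nat) (G : 'I_n -> rel 'I_n) : Prop :=
  exists (v c : {perm 'I_n}), forall k : 'I_n, G (c k) (v k) (v (ordS k)).
Arguments clique_pendant : clear implicits.

(* Main.v *)
Require Import Defs.
From HB Require Import structures.
From mathcomp Require Import all_boot all_order all_algebra all_fingroup.
From mathcomp Require Import reals zify.
Import Order.TTheory GRing.Theory Num.Theory.

(** Bounding an eigenvector at the vertex [x] where [|v x| / deg x] is largest
    gives [rho * deg x <= deg x ^ 2 + \sum_(y ~ x) deg y]; with [rho > 2n - 4]
    this forces [deg x >= n - 2], and then at most [n - 2] non-edges in each graph.

    Let [w x y] be the number of graphs missing the pair [xy].  A Hamiltonian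
    cycle that is locally minimal for 2-opt exchanges has total weight at most
    [2n - 3].  The edges of such a cycle can be matched with the graphs unless the
    cycle contains a dead edge, i.e. one of weight [n].  If [xy] is a dead edge of
    a cycle of weight at most [2n - 3], the [n - 1] exchanges of [xy] with the other
    edges either produce a rainbow cycle or exhaust the whole weight [n (n - 2)]:
    each exchange then creates one new dead edge and one of weight [0], and no
    weight lies off [x] and [y].  The new cycles are as light, so the same applies
    to every dead edge at [x] or [y].  If both [x] and [y] carried a second dead
    edge, they would carry at most 4 together, whereas the count gives
    [n - 1 >= 5]; hence the dead edges form a star with [n - 2] edges. *)

(** * Hamiltonian cycles and 2-opt exchanges *)

Definition tour_sum {n : nat} (f : 'I_n -> 'I_n -> nat) (v : {perm 'I_n}) : nat :=
  \sum_k f (v k) (v (ordS k)).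

Lemma ordSE {n : nat} (k : 'I_n) : ordS k = (if k.+1 == n then 0 else k.+1) :> nat.
Proof.
have := ltn_ord k; rewrite /=; case: eqP => [->|ne] kn; first by rewrite modnn.
by rewrite modn_small //; lia.
Qed.

Lemma ordS_neq {n : nat} (k : 'I_n) : 1 < n -> ordS k != k.
Proof.
move=> n1; apply/eqP => /(congr1 (@nat_of_ord n)); rewrite ordSE.
by case: eqP; lia.
Qed.

Lemma ordSS_neq {n : nat} (k : 'I_n) : 2 < n -> ordS (ordS k) != k.
Proof.
move=> n2; apply/eqP => /(congr1 (@nat_of_ord n)); rewrite !ordSE.
by move: (ltn_ord k); do ![case: eqP]; lia.
Qed.

(* For [i < j], the reversal of positions [i+1..j] realises the 2-opt exchange of
   [two_opt], and that of [i+1..j-1] matches the old and new edges in between. *)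
Lemma interval_reversal (n a b : nat) : b < n ->
  exists r : {perm 'I_n},
    forall k, r k = (if a <= k <= b then a + b - k else k) :> nat.
Proof.
move=> bn.
have lt (k : 'I_n) : (if a <= k <= b then a + b - k else k) < n.
  by move: (ltn_ord k); case: ifP; lia.
have inj : injective (fun k => Ordinal (lt k)).
  move=> k l /(congr1 val) /= E; apply/ord_inj => /=; move: E.
  by case: ifP; case: ifP; lia.
by exists (perm inj) => k; rewrite permE.
Qed.

(* Quantifying over all symmetric [f] expresses that the edge multiset of [v'] is that
   of [v] with two edges exchanged; indicator functions [f] track single edges. *)
Lemma two_opt {n : nat} (v : {perm 'I_n}) (i j : 'I_n) : i != j ->
  exists v' : {perm 'I_n}, forall f : 'I_n -> 'I_n -> nat,
    (forall x y, f x y = f y x) ->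
    tour_sum f v' + f (v i) (v (ordS i)) + f (v j) (v (ordS j)) =
    tour_sum f v + f (v i) (v j) + f (v (ordS i)) (v (ordS j)).
Proof.
wlog lij : i j / i < j => [wl nij|_].
  have [lij|lji|/val_inj eij] := ltngtP i j; first exact: wl.
    have nji : j != i by rewrite eq_sym.
    have [v' Hv'] := wl j i lji nji; exists v' => f fC.
    by have := Hv' f fC; rewrite (fC (v j) (v i)) (fC (v (ordS j))); lia.
  by rewrite eij eqxx in nij.
have jn := ltn_ord j; have j1n : j.-1 < n by lia.
have [r rE] := @interval_reversal n i.+1 j jn.
have [t tE] := @interval_reversal n i.+1 j.-1 j1n.
exists (r * v)%g => f fC.
have nji : j != i by rewrite -val_eqE /=; lia.
have ti : t i = i by apply/ord_inj; rewrite tE; case: ifP; lia.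
have tj : t j = j by apply/ord_inj; rewrite tE; case: ifP; lia.
have ri : r i = i by apply/ord_inj; rewrite rE; case: ifP; lia.
have rSi : r (ordS i) = j.
  by apply/ord_inj; rewrite rE ordSE; case: (i.+1 =P n); last case: ifP; lia.
have rj : r j = ordS i.
  by apply/ord_inj; rewrite rE [RHS]ordSE; case: (i.+1 =P n); first lia; case: ifP; lia.
have rSj : r (ordS j) = ordS j.
  by apply/ord_inj; rewrite rE !ordSE; case: (j.+1 =P n) => // _; case: ifP; lia.
rewrite /tour_sum (bigD1 i) //= (bigD1 j) //= !permM ri rSi rj rSj.
have -> : \sum_k f (v k) (v (ordS k)) = \sum_k f (v (t k)) (v (ordS (t k))).
  exact: (reindex_inj (@perm_inj _ t)).
rewrite [in RHS](bigD1 i) //= [in RHS](bigD1 j) //= ti tj.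
set s1 := \sum_(_ | _) _; set s2 := \sum_(_ | _) _.
suff -> : s1 = s2 by rewrite (fC (v (ordS i)) (v (ordS j))) (fC (v (ordS j))); lia.
apply: eq_bigr => k /andP[ki kj]; rewrite !permM.
have kn := ltn_ord k.
have ki' : k <> i :> nat by move/val_inj/eqP; rewrite (negPf ki).
have kj' : k <> j :> nat by move/val_inj/eqP; rewrite (negPf kj).
(* Strictly between [i] and [j], the new edge at [k] is the old edge at [t k = i + j - k] traversed
   backwards; elsewhere both reversals act trivially. *)
have [/andP[ik kj2]|nb] := boolP (i < k < j).
  have -> : r k = ordS (t k).
    apply/ord_inj; rewrite rE [RHS]ordSE tE ik.
    have -> : k <= j by lia.
    have -> : k <= j.-1 by lia.
    by rewrite /=; case: (_ =P n) => [|_]; lia.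
  have -> : r (ordS k) = t k.
    apply/ord_inj; rewrite rE ordSE tE ik.
    have -> : k <= j.-1 by lia.
    case: (k.+1 =P n) => [|_]; first by lia.
    by rewrite /=; case: ifP; lia.
  exact: fC.
have -> : t k = k by apply/ord_inj; rewrite tE; case: ifP; lia.
have -> : r k = k by apply/ord_inj; rewrite rE; case: ifP; lia.
suff -> : r (ordS k) = ordS k by [].
by apply/ord_inj; rewrite rE ordSE; case: (k.+1 =P n) => // ?; case: ifP; lia.
Qed.

(** A lightest tour is not improved by any exchange. Summing these inequalities over ordered pairs
    of positions counts each tour edge [2 (n - 1)] times on the left, while on the right each
    ordered pair of vertices occurs twice. *)
Lemma exists_low_weight_tour {n : nat} (w : 'I_n -> 'I_n -> nat) :
  0 < n -> (forall x y, w x y = w y x) -> (forall x, w x x = 0) ->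
  exists v : {perm 'I_n}, n.-1 * tour_sum w v <= \sum_x \sum_y w x y.
Proof.
move=> n0 wC w0.
pose v : {perm 'I_n} := [arg min_(u < 1%g) tour_sum w u].
have vmin u : tour_sum w v <= tour_sum w u.
  by rewrite /v; case: arg_minnP => // u0 _; apply.
exists v.
pose e i := w (v i) (v (ordS i)).
have step i j : i != j ->
    e i + e j <= w (v i) (v j) + w (v (ordS i)) (v (ordS j)).
  move=> ij; have [v' Hv'] := two_opt v _ _ ij.
  by have := Hv' w wC; have := vmin v'; rewrite /e; lia.
have le2 : \sum_i \sum_(j | j != i) (e i + e j) <=
    \sum_i \sum_(j | j != i) (w (v i) (v j) + w (v (ordS i)) (v (ordS j))).
  by apply: leq_sum => i _; apply: leq_sum => j ji; apply: step; rewrite eq_sym.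
have drop0 i (F : 'I_n -> nat) : F i = 0 -> \sum_(j | j != i) F j = \sum_j F j.
  by move=> F0; rewrite [RHS](bigD1 i) //= F0.
have perm_sum (s : 'I_n -> 'I_n) : injective s ->
    \sum_i \sum_j w (s i) (s j) = \sum_x \sum_y w x y.
  move=> sI; rewrite [RHS](reindex_inj sI); apply: eq_bigr => i _.
  by rewrite [RHS](reindex_inj sI).
have rhs : \sum_i \sum_(j | j != i) (w (v i) (v j) + w (v (ordS i)) (v (ordS j)))
    = 2 * \sum_x \sum_y w x y.
  transitivity (\sum_i (\sum_j w (v i) (v j) + \sum_j w (v (ordS i)) (v (ordS j)))).
    by apply: eq_bigr => i _; rewrite drop0 ?w0 // big_split.
  rewrite big_split /= (perm_sum v perm_inj).
  by rewrite (perm_sum (v \o ordS (n:=n)) (inj_comp perm_inj (@ordS_inj n))) mul2n addnn.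
have lhs : \sum_i \sum_(j | j != i) (e i + e j) = 2 * (n.-1 * tour_sum w v).
  have card_neq (i : 'I_n) : \sum_(j | j != i) 1 = n.-1.
    by rewrite sum1_card cardC1 card_ord.
  transitivity (\sum_i (n.-1 * e i + \sum_(j | j != i) e j)).
    apply: eq_bigr => i _; rewrite big_split /=; congr (_ + _).
    by rewrite -(card_neq i) big_distrl /=; apply: eq_bigr => j _; rewrite mul1n.
  rewrite big_split /= -big_distrr /= (exchange_big_dep xpredT) //=.
  transitivity (n.-1 * tour_sum w v + \sum_j n.-1 * e j).
    congr (_ + _); apply: eq_bigr => j _.
    under eq_bigl do rewrite eq_sym.
    by rewrite -(card_neq j) big_distrl /=; apply: eq_bigr => i _; rewrite mul1n.
  by rewrite -big_distrr /= mul2n addnn.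
by move: le2; rewrite lhs rhs leq_pmul2l.
Qed.

(** * Matching positions with graphs *)

(** Some assignment has at most one bad position [k0]. If it cannot be repaired, the [a] good
    entries of row [k0] and the [b] good entries of column [k0] force [a b] bad entries off that row
    and column. With the bad ones in the row and column this makes
    [2n - 1 - a - b + a b >= 2n - 2]. *)
Lemma matching_of_few_bad {n : nat} (B : 'I_n -> 'I_n -> bool) :
  \sum_k \sum_g B k g < 2 * n - 2 ->
  (forall k, exists g, ~~ B k g) -> (forall g, exists k, ~~ B k g) ->
  exists c : {perm 'I_n}, forall k, ~~ B k (c k).
Proof.
case: n B => [|n] B small rowB colB; first by exists 1%g; case.
(* Averaging over the [n] cyclic shifts. *)
have [c c1] : exists c : {perm 'I_n.+1}, \sum_k B k (c k) <= 1.
  pose sh s := perm (@addIr _ (s : 'I_n.+1)).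
  have tot : \sum_s \sum_k (B k (sh s k) : nat) = \sum_k \sum_g B k g.
    rewrite exchange_big; apply: eq_bigr => k _.
    rewrite [RHS](reindex_inj (@addrI _ k)).
    by apply: eq_bigr => s _; rewrite permE.
  have [/existsP[s Hs]|/existsPn none] :=
      boolP [exists s, \sum_k (B k (sh s k) : nat) <= 1]; first by exists (sh s).
  have : \sum_(s : 'I_n.+1) 2 <= \sum_s \sum_k (B k (sh s k) : nat).
    by apply: leq_sum => s _; rewrite ltnNge none.
  by rewrite tot sum_nat_const card_ord => /leq_ltn_trans /(_ small) ?; exfalso; lia.
have [/existsP[c' /forallP c'P]|/existsPn none] :=
    boolP [exists c' : {perm 'I_n.+1}, forall k, ~~ B k (c' k)]; first by exists c'.
have := none c; rewrite negb_forall => /existsP[k0]; rewrite negbK => Bk0.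
have good k : k != k0 -> ~~ B k (c k).
  move=> kk0; apply/negP => Bk; move: c1.
  by rewrite (bigD1 k0) //= (bigD1 k) //= Bk0 Bk.
pose P k l := B k (c l).
(* Otherwise moving the bad assignment along [k0 -> j -> m -> k0] would repair [c]. *)
have blocked j m : ~~ P k0 j -> ~~ P m k0 -> P j m.
  rewrite /P => Bj Bm.
  have jk0 : j != k0 by apply: contraNneq Bj => ->.
  have mk0 : m != k0 by apply: contraNneq Bm => ->.
  apply/negPn/negP => Bjm.
  have [ejm|jm] := eqVneq j m.
    have := none (tperm k0 j * c)%g; rewrite negb_forall => /existsP[k].
    rewrite permM; case: tpermP => [->|->|/eqP k1 _]; rewrite ?Bj ?ejm ?Bm //.
    by rewrite good.
  have := none (tperm k0 j * tperm k0 m * c)%g.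
  rewrite negb_forall => /existsP[k]; rewrite !permM.
  case: (tpermP k0 j) => [->|->|/eqP k1 /eqP k2].
  - by rewrite tpermD // ?Bj // eq_sym.
  - by rewrite tpermL Bjm.
  - case: tpermP => [/eqP|->|/eqP k3 _]; rewrite ?(negPf k1) ?Bm //.
    by rewrite good.
exfalso.
have tot : \sum_k \sum_g B k g = \sum_k \sum_l P k l.
  by apply: eq_bigr => k _; apply: (reindex_inj (@perm_inj _ c)).
pose a := \sum_l ~~ P k0 l; pose b := \sum_k ~~ P k k0.
have compl (F : 'I_n.+1 -> bool) : \sum_l F l + \sum_l ~~ F l = n.+1.
  rewrite -big_split /= -[RHS]card_ord -sum1_card; apply: eq_bigr => l _.
  by case: (F l).
have pos (F : 'I_n.+1 -> bool) : (exists l, F l) -> 0 < \sum_l F l.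
  by case=> l Fl; rewrite (bigD1 l) //= Fl.
have a0 : 0 < a.
  by apply: pos; have [g Bg] := rowB k0; exists (c^-1 g)%g; rewrite /P permKV.
have b0 : 0 < b by apply: pos; exact: colB.
have row k : k != k0 -> P k k0 + (~~ P k0 k) * b <= \sum_l P k l.
  move=> kk0; rewrite [leqRHS](bigD1 k0) //= leq_add2l.
  case: (boolP (P k0 k)) => [//|Pk]; rewrite mul1n /b (bigD1 k0) //= {1}/P Bk0 add0n.
  apply: leq_sum => m _; case: (boolP (P m k0)) => // Pm.
  by rewrite blocked.
have ha := compl (P k0); have hb := compl (P^~ k0).
move: small; rewrite tot (bigD1 k0) //=.
have : \sum_(k | k != k0) (P k k0 + (~~ P k0 k) * b) <=
       \sum_(k | k != k0) \sum_l P k l by exact: leq_sum.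
rewrite big_split /= -big_distrl /=.
move: hb; rewrite (bigD1 k0) //= {1}/P Bk0.
have -> : \sum_(k | k != k0) ~~ P k0 k = a by rewrite /a [RHS](bigD1 k0) //= {2}/P Bk0.
(* This is [(a - 1) (b - 1) >= 0]; positivity of [a] and [b] is where the row and column hypotheses
   enter. *)
have ab : a + b <= a * b + 1 by rewrite -(prednK a0) -(prednK b0); nia.
move: ha; rewrite -/a -/b.
move: ab; clearbody a b.
set s1 := \sum_l P k0 l; set s2 := \sum_(i | i != k0) P i k0.
set s3 := \sum_(i | _) \sum_l _; move: (a * b) s1 s2 s3 => ab s1 s2 s3.
rewrite /=; lia.
Qed.

(** * Dead edges on light cycles *)

Definition same_edge {T : eqType} (x y p q : T) : bool :=
  (x == p) && (y == q) || (x == q) && (y == p).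

Definition on_tour {n : nat} (v : {perm 'I_n}) (x y : 'I_n) : Prop :=
  exists k, same_edge x y (v k) (v (ordS k)).

(* 2n - 2 is the least number of bad pairs with which an [n] by [n] matching can be
   blocked without a full row or column; see [matching_of_few_bad]. *)
Definition light_dead_edge {n : nat} (w : 'I_n -> 'I_n -> nat) (x y : 'I_n) : Prop :=
  n <= w x y /\ exists2 v, tour_sum w v < 2 * n - 2 & on_tour v x y.

Lemma same_edgeC {T : eqType} (x y p q : T) : same_edge x y p q = same_edge x y q p.
Proof. by rewrite /same_edge orbC. Qed.

Lemma same_edgeCl {T : eqType} (x y p q : T) : same_edge x y p q = same_edge y x p q.
Proof. by rewrite /same_edge orbC; congr (_ || _); apply: andbC. Qed.

Lemma light_dead_edgeC {n : nat} (w : 'I_n -> 'I_n -> nat) (x y : 'I_n) :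
  (forall x y, w x y = w y x) -> light_dead_edge w x y -> light_dead_edge w y x.
Proof.
move=> wC [dxy [v vW [k vk]]]; split; first by rewrite wC.
by exists v => //; exists k; rewrite same_edgeCl.
Qed.

Lemma tour_sum_gt0 {n : nat} (f : 'I_n -> 'I_n -> bool) (v : {perm 'I_n}) :
  0 < tour_sum f v -> exists k, f (v k) (v (ordS k)).
Proof.
move=> pos; apply/existsP; apply: contraLR pos => /existsPn none.
by rewrite -eqn0Ngt /tour_sum big1 // => k _; rewrite (negPf (none k)).
Qed.

(** If [a + b <= n], trading the dead edge at [i] and the edge at [j] for the two new ones gives a
    cycle that is no heavier, so it has a dead edge too, necessarily a new one. This excludes
    [a + b < n]; for [a + b = n] the new dead edge is again light. *)
Lemma two_opt_dead_edge {n : nat} (w : 'I_n -> 'I_n -> nat) (v : {perm 'I_n})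
    (i j : 'I_n) :
  2 < n -> (forall x y, w x y = w y x) -> (forall x, w x x = 0) ->
  (forall v, tour_sum w v < 2 * n - 2 -> exists k, n <= w (v k) (v (ordS k))) ->
  tour_sum w v < 2 * n - 2 -> n <= w (v i) (v (ordS i)) -> i != j ->
  let a := w (v i) (v j) in let b := w (v (ordS i)) (v (ordS j)) in
  n <= a + b /\
  (a + b = n -> [/\ n <= a \/ n <= b,
     n <= a -> light_dead_edge w (v i) (v j) &
     n <= b -> light_dead_edge w (v (ordS i)) (v (ordS j))]).
Proof.
move=> n2 wC w0 dead vW vi ij a b.
have [v' Hv'] := two_opt v _ _ ij.
have W2 (k l : 'I_n) : k != l ->
    w (v k) (v (ordS k)) + w (v l) (v (ordS l)) <= tour_sum w v.
  move=> kl; rewrite /tour_sum (bigD1 k) //= (bigD1 l) 1?eq_sym //=; lia.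
have Wij := W2 i j ij.
have HW := Hv' w wC; rewrite -/a -/b in HW.
have on_v' p q : same_edge p q (v i) (v j) \/ same_edge p q (v (ordS i)) (v (ordS j)) ->
    on_tour v' p q.
  (* The exchange identity for the indicator of [pq]: the old tour pays for the two removed edges,
     so the added ones remain in the count for [v']. *)
  move=> pq; apply: tour_sum_gt0.
  have := Hv' (fun s t => same_edge p q s t : nat) (fun s t => congr1 _ (same_edgeC p q s t)).
  have : same_edge p q (v i) (v (ordS i)) + same_edge p q (v j) (v (ordS j)) <=
      tour_sum (fun s t => same_edge p q s t : nat) v.
    by rewrite /tour_sum (bigD1 i) //= (bigD1 j) 1?eq_sym //=; lia.
  move: (tour_sum _ v) (tour_sum _ v') => s s' /=.
  by case: pq => ->; lia.
(* Two dead edges would weigh [2n] already, so [v] has only the one at [i], which the exchange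
   removes. The function [f] counts dead edges. *)
have ab_dead : tour_sum w v' < 2 * n - 2 -> n <= a \/ n <= b.
  move=> /dead[k v'k].
  pose f s t : nat := n <= w s t.
  have := Hv' f (fun s t => congr1 (fun m => nat_of_bool (n <= m)) (wC s t)).
  have : 0 < tour_sum f v' by rewrite /tour_sum (bigD1 k) //= /f v'k.
  have : tour_sum f v <= 1.
    rewrite /tour_sum (bigD1 i) //= /f vi big1 // => l li.
    by have := W2 l i li; case: leqP => // ?; lia.
  move: (tour_sum f v) (tour_sum f v') => s s'; rewrite /f vi -/a -/b.
  by case: (leqP n a); case: (leqP n b); auto; lia.
split=> [|abn].
  have [/ab_dead[]|] := ltnP (tour_sum w v') (2 * n - 2); lia.
have v'W : tour_sum w v' < 2 * n - 2 by lia.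
split; first exact: ab_dead.
  by move=> na; split=> //; exists v' => //; apply: on_v'; left; rewrite /same_edge !eqxx.
by move=> nb; split=> //; exists v' => //; apply: on_v'; right; rewrite /same_edge !eqxx.
Qed.

Lemma sum_off_pair {n : nat} (w : 'I_n -> 'I_n -> nat) (x y : 'I_n) :
  (forall x y, w x y = w y x) -> (forall x, w x x = 0) -> x != y ->
  \sum_p \sum_q w p q + 2 * w x y =
  2 * (\sum_q w x q + \sum_q w y q) +
  \sum_(p | (p != x) && (p != y)) \sum_(q | (q != x) && (q != y)) w p q.
Proof.
move=> wC w0 xy.
have yx : y != x by rewrite eq_sym.
have split_sum F : \sum_(p : 'I_n) F p = F x + (F y + \sum_(p | (p != x) && (p != y)) F p).
  by rewrite (bigD1 x) //= (bigD1 y).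
have inner p : \sum_q w p q = w x p + (w y p + \sum_(q | (q != x) && (q != y)) w p q).
  by rewrite split_sum (wC p x) (wC p y).
rewrite split_sum.
have -> : \sum_(p | (p != x) && (p != y)) \sum_q w p q =
   \sum_(p | (p != x) && (p != y)) w x p + \sum_(p | (p != x) && (p != y)) w y p +
   \sum_(p | (p != x) && (p != y)) \sum_(q | (q != x) && (q != y)) w p q.
  by rewrite -!big_split /=; apply: eq_bigr => p _; rewrite inner addnA.
rewrite (split_sum (w x)) (split_sum (w y)) !w0 (wC y x); lia.
Qed.

(** The exchanges of [xy] with the other [n - 1] edges give rows [x] and [y] a joint sum of at least
    [n (n - 1)]. By [sum_off_pair] the total weight allows no more, so every inequality used is an
    equality. *)
Lemma light_dead_edge_rigid {n : nat} (w : 'I_n -> 'I_n -> nat) (x y : 'I_n) :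
  2 < n -> (forall x y, w x y = w y x) -> (forall x, w x x = 0) ->
  (forall x y, w x y <= n) ->
  \sum_x \sum_y w x y <= 2 * (n * (n - 2)) ->
  (forall v, tour_sum w v < 2 * n - 2 -> exists k, n <= w (v k) (v (ordS k))) ->
  light_dead_edge w x y ->
  [/\ forall z, w x z = 0 \/ w x z = n,
      forall z, w x z = n -> light_dead_edge w x z,
      forall p q, p != x -> p != y -> q != x -> q != y -> w p q = 0 &
      \sum_z w x z + \sum_z w y z = n * n.-1].
Proof.
move=> n2 wC w0 wn total dead [dxy [v vW [i vi]]].
have vin : n <= w (v i) (v (ordS i)).
  by case/orP: vi dxy => /andP[/eqP-> /eqP->]; rewrite // wC.
have nvi : v i != v (ordS i).
  by rewrite (inj_eq perm_inj) eq_sym ordS_neq // ltnW.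
have opt j := two_opt_dead_edge w v i j n2 wC w0 dead vW vin.
set a := fun j => w (v i) (v j); set b := fun j => w (v (ordS i)) (v (ordS j)).
have ai : a i = 0 by exact: w0.
have bi : b i = 0 by exact: w0.
have sum_a : \sum_(j | j != i) a j = \sum_z w (v i) z.
  by rewrite [RHS](reindex_inj (@perm_inj _ v)) /= [RHS](bigD1 i) //= w0.
have sum_b : \sum_(j | j != i) b j = \sum_z w (v (ordS i)) z.
  rewrite [RHS](reindex_inj (inj_comp (@perm_inj _ v) (@ordS_inj n))) /=.
  by rewrite [RHS](bigD1 i) //= w0.
have sum_n : \sum_(j : 'I_n | j != i) n = n * n.-1.
  by rewrite sum_nat_const cardC1 card_ord mulnC.
have ge_ab j : j != i -> n <= a j + b j.
  by rewrite eq_sym => /opt[].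
have off := sum_off_pair w _ _ wC w0 nvi.
have we : w (v i) (v (ordS i)) = n by apply/eqP; rewrite eqn_leq wn.
have sum_ab : n * n.-1 <= \sum_z w (v i) z + \sum_z w (v (ordS i)) z.
  by rewrite -sum_n -sum_a -sum_b -big_split /=; apply: leq_sum.
have n_eq : 2 * (n * n.-1) = 2 * (n * (n - 2)) + 2 * n.
  by rewrite -(prednK (ltnW (ltnW n2))) /=; nia.
rewrite we in off.
have off0 : \sum_(p | (p != v i) && (p != v (ordS i)))
    \sum_(q | (q != v i) && (q != v (ordS i))) w p q = 0.
  by move: off total sum_ab; do !move: (bigop _ _ _); lia.
have sum_eq : \sum_z w (v i) z + \sum_z w (v (ordS i)) z = n * n.-1.
  by move: off total sum_ab; do !move: (bigop _ _ _); lia.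
have eq_ab j : j != i -> a j + b j = n.
  move=> ji; apply/eqP; rewrite eqn_leq ge_ab // andbT leqNgt; apply/negP => gt.
  have : \sum_(j | j != i) n < \sum_(j | j != i) (a j + b j).
    rewrite (bigD1 j) //= [ltnRHS](bigD1 j) //= -addSn leq_add //.
    by apply: leq_sum => l /andP[/ge_ab].
  by rewrite big_split /= sum_a sum_b sum_eq sum_n ltnn.
have zero p q : p != v i -> p != v (ordS i) -> q != v i -> q != v (ordS i) -> w p q = 0.
  move=> p1 p2 q1 q2; move: off0; rewrite (bigD1 p) ?p1 //= (bigD1 q) ?q1 //=; lia.
(* Both ends are treated, since [x] may be either end of the tour edge at [i]. *)
have orient : 
  [/\ forall z, w (v i) z = 0 \/ w (v i) z = n,
      forall z, w (v i) z = n -> light_dead_edge w (v i) z,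
      forall z, w (v (ordS i)) z = 0 \/ w (v (ordS i)) z = n &
      forall z, w (v (ordS i)) z = n -> light_dead_edge w (v (ordS i)) z].
  have cases j : [/\ a j = 0 \/ a j = n, b j = 0 \/ b j = n,
      a j = n -> light_dead_edge w (v i) (v j) &
      b j = n -> light_dead_edge w (v (ordS i)) (v (ordS j))].
    have [->|ji] := eqVneq j i; first by rewrite ai bi; split; auto; lia.
    have := opt j; rewrite eq_sym => /(_ ji) [_ /(_ (eq_ab j ji))[]].
    have := eq_ab j ji; rewrite -/(a j) -/(b j) => abn h da db.
    split; [lia|lia|by move=> E; apply: da; rewrite E|].
    by move=> E; apply: db; rewrite E.
  split=> z.
  - by rewrite -(permKV v z); have [] := cases (v^-1 z)%g.
  - by rewrite -(permKV v z); have [] := cases (v^-1 z)%g.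
  (* [b j] concerns the vertex after position [j], so [z] is reached from the position before its
     own. *)
  - by rewrite -(permKV v z) -(ord_predK (v^-1 z)%g); have [] := cases (ord_pred (v^-1 z)%g).
  - by rewrite -(permKV v z) -(ord_predK (v^-1 z)%g); have [] := cases (ord_pred (v^-1 z)%g).
have [o1 o2 o3 o4] := orient.
case/orP: vi => /andP[/eqP-> /eqP->]; split=> //; first by auto.
by rewrite addnC.
Qed.

(** * The weights form a star *)

(** The complement of [K_1 \/ (K_{n-2} \cup K_1)], where [x] is the pendant vertex and [z] its only
    neighbour. *)
Definition star_but {n : nat} (x z p q : 'I_n) : bool :=
  (p != q) && ((p == x) && (q != z) || (q == x) && (p != z)).

Lemma sum_eq1 {n : nat} (x : 'I_n) : \sum_z (z == x) = 1.
Proof. by rewrite (bigD1 x) //= eqxx big1 // => z /negPf->. Qed.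

(** Since [y] carries only the dead edge [xy], row [x] sums to [n (n - 2)]. Its entries are [0] or
    [n], so exactly one vertex [z] other than [x] has weight [0] with [x]. *)
Lemma star_of_leaf {n : nat} (w : 'I_n -> 'I_n -> nat) (x y : 'I_n) :
  5 < n -> (forall x y, w x y = w y x) -> (forall x, w x x = 0) -> w x y = n ->
  (forall z, w x z = 0 \/ w x z = n) -> (forall z, w y z = 0 \/ w y z = n) ->
  (forall p q, p != x -> p != y -> q != x -> q != y -> w p q = 0) ->
  \sum_z w x z + \sum_z w y z = n * n.-1 ->
  (forall t, t != x -> w y t <> n) ->
  exists x z, x != z /\ forall p q, w p q = if star_but x z p q then n else 0.
Proof.
move=> n5 wC w0 wxy wx wy off sum leaf.
have wy0 t : t != x -> w y t = 0 by move=> tx; have [//|/leaf] := wy t; case.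
have sum_y : \sum_z w y z = n.
  by rewrite (bigD1 x) //= big1 // wC wxy addn0.
have sum_x : \sum_z w x z + n = n * n.-1 by rewrite -sum sum_y.
have [/existsP[z /andP[zx /eqP xz0]]|/existsPn none] :=
    boolP [exists z, (z != x) && (w x z == 0)]; last first.
  exfalso; move: sum_x; rewrite (bigD1 x) //= w0.
  rewrite (eq_bigr (fun=> n)); last first.
    by move=> z zx; have := none z; rewrite zx /=; case: (wx z) => [->|].
  by rewrite sum_nat_const cardC1 card_ord mulnC; lia.
have xn z' : z' != x -> z' != z -> w x z' = n.
  move=> z'x z'z; have [z'0|//] := wx z'; exfalso.
  (* Zeros at [x], [z] and [z'] would leave row [x] at most [n (n - 3)]. *)
  have : \sum_t (w x t + n * (t == x) + n * (t == z) + n * (t == z')) <= \sum_(t : 'I_n) n.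
    apply: leq_sum => t _.
    have [->|tx] := eqVneq t x.
      by rewrite w0 (eq_sym x) (negPf zx) (eq_sym x) (negPf z'x); lia.
    have [->|tz] := eqVneq t z.
      by rewrite xz0 (eq_sym z) (negPf z'z); lia.
    have [->|tz'] := eqVneq t z'; first by rewrite z'0; lia.
    by case: (wx t) => ->; lia.
  rewrite !big_split /= -!big_distrr /= !sum_eq1 sum_nat_const card_ord.
  have : n * n.-1 + n = n * n by rewrite addnC -mulnS prednK //; lia.
  move: sum_x; move: (\sum_z _) => s; nia.
have off' p q : p != x -> q != x -> w p q = 0.
  move=> px qx; have [->|py] := eqVneq p y; first exact: wy0.
  have [->|qy] := eqVneq q y; first by rewrite wC wy0.
  exact: off.
exists x, z; split; first by rewrite eq_sym.
move=> p q; rewrite /star_but.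
have [->|pq] /= := eqVneq p q; first exact: w0.
have [epx|px] /= := eqVneq p x.
  rewrite epx in pq *; have [->|qz] /= := eqVneq q z; first by rewrite (negPf zx).
  by apply: xn; rewrite // eq_sym.
have [->|qx] /= := eqVneq q x; last exact: off'.
rewrite wC; have [->|pz] //= := eqVneq p z.
exact: xn.
Qed.

Lemma star_of_dead_tours {n : nat} (w : 'I_n -> 'I_n -> nat) :
  5 < n -> (forall x y, w x y = w y x) -> (forall x, w x x = 0) ->
  (forall x y, w x y <= n) ->
  \sum_x \sum_y w x y <= 2 * (n * (n - 2)) ->
  (forall v, tour_sum w v < 2 * n - 2 -> exists k, n <= w (v k) (v (ordS k))) ->
  exists x z, x != z /\ forall p q, w p q = if star_but x z p q then n else 0.
Proof.
move=> n5 wC w0 wn total dead.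
have n2 : 2 < n by lia.
have [v vW] := exists_low_weight_tour w (ltn_trans (isT : 0 < 2) n2) wC w0.
(* Indeed [(n - 1) (2n - 2) = 2n (n - 2) + 2] exceeds the total weight. *)
have {}vW : tour_sum w v < 2 * n - 2.
  move: (leq_trans vW total); move: (tour_sum w v) => s H.
  rewrite ltnNge; apply/negP => H2.
  have : n.-1 * (2 * n - 2) <= n.-1 * s by rewrite leq_mul2l H2 orbT.
  by move=> /leq_trans /(_ H); clear -n2; nia.
have [k vk] := dead v vW.
have [x [y L]] : exists x y, light_dead_edge w x y.
  exists (v k), (v (ordS k)); split=> //; exists v => //; exists k.
  by rewrite /same_edge !eqxx.
have rig a b := @light_dead_edge_rigid n w a b n2 wC w0 wn total dead.
have [ax dx off sum] := rig x y L.
have L' := light_dead_edgeC w x y wC L.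
have [ay dy off2 sum2] := rig y x L'.
have wxy : w x y = n by apply/eqP; rewrite eqn_leq wn; case: L => ->.
have xy : x != y by apply/eqP => E; move: wxy; rewrite E w0; lia.
have [/existsP[s /andP[sy /eqP ws]]|/existsPn none] :=
    boolP [exists s, (s != y) && (w x s == n)]; last first.
  apply: (star_of_leaf w y x) => //; first by rewrite wC.
  by move=> t ty E; have := none t; rewrite ty E eqxx.
have [/existsP[t /andP[tx /eqP wt]]|/existsPn none] :=
    boolP [exists t, (t != x) && (w y t == n)]; last first.
  apply: (star_of_leaf w x y) => //.
  by move=> t tx E; have := none t; rewrite tx E eqxx.
(* Rigidity at [xs] lets [y] have weight only with [x] and [s]; rigidity at [yt] lets [x] have
   weight only with [y] and [t]. The two rows then sum to at most [4n < n (n - 1)]. *)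
have [_ _ offs _] := rig x s (dx s ws); have [_ _ offt _] := rig y t (dy t wt).
have bound a b c : (forall u, w a u = 0 \/ w a u = n) ->
    (forall u, w a u = n -> u = b \/ u = c) -> \sum_u w a u <= 2 * n.
  move=> a0n only; apply: (@leq_trans (\sum_u (n * (u == b) + n * (u == c)))).
    apply: leq_sum => u _; case: (a0n u) => [->//|E].
    by rewrite E; case: (only u E) => ->; rewrite eqxx; lia.
  by rewrite big_split /= -!big_distrr /= !sum_eq1; lia.
have sum_wx_le : \sum_u w x u <= 2 * n.
  apply: (bound x y t) => // u E.
  have [->|uy] := eqVneq u y; [by left|right]; apply/eqP/negPn/negP => ut.
  by have := offt x u xy; rewrite E (eq_sym x) => /(_ tx uy ut); lia.
have sum_wy_le : \sum_u w y u <= 2 * n.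
  apply: (bound y x s) => // u E.
  have [->|ux] := eqVneq u x; [by left|right]; apply/eqP/negPn/negP => us.
  by have := offs y u; rewrite E eq_sym xy (eq_sym y) => /(_ isT sy ux us); lia.
exfalso; move: sum_wx_le sum_wy_le sum; move: (\sum_u w x u) (\sum_u w y u) => s1 s2.
move=> h1 h2 h3; have : n * 5 <= n * n.-1 by rewrite leq_mul2l; lia.
lia.
Qed.

(** * From the signless Laplacian to few non-edges *)

Definition non_edge {n : nat} (G : rel 'I_n) (x y : 'I_n) : bool :=
  (x != y) && ~~ G x y.

Local Open Scope ring_scope.

(** This is the maximal row-sum bound for the signless Laplacian conjugated by the degree matrix,
    read off at the row where [|v x| / deg x] is largest. *)
Lemma eigen_degree_bound (R : realType) (n : nat) (G : rel 'I_n) (r : R) :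
  simple_graph G -> eigenvalue (signless_laplacian R G) r -> 0 < r ->
  exists x, (0 < deg G x)%N /\
    r * (deg G x)%:R <= (deg G x ^ 2 + \sum_(y | G x y) deg G y)%:R.
Proof.
move=> [Gsym Girr] /eigenvalueP[v veq v0] r0.
pose d x : R := (deg G x)%:R.
have entry x : r * v ord0 x = v ord0 x * d x + \sum_(y | G x y) v ord0 y.
  have := congr1 (fun u : 'rV[R]_n => u ord0 x) veq; rewrite !mxE => <-.
  under eq_bigr => y _ do rewrite !mxE mulrDr.
  rewrite big_split /=; congr (_ + _).
    by rewrite (bigD1 x) //= eqxx mul1r big1 ?addr0 // => y /negPf->; rewrite mul0r mulr0.
  rewrite [RHS]big_mkcond /=; apply: eq_bigr => y _; rewrite Gsym.
  by case: (G x y); rewrite ?mulr1 ?mulr0.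
(* Vertices of degree [0] must be kept out of the maximum of quotients; their rows vanish, so
   [0 < r] makes their entries [0]. *)
have isolated x : deg G x = 0%N -> v ord0 x = 0.
  move=> dx; have := entry x; rewrite /d dx mulr0 add0r big_pred0 => [/eqP|y].
    by rewrite mulf_eq0 gt_eqF // => /eqP.
  apply/negP => Gxy; have : (0 < deg G x)%N by apply/card_gt0P; exists y; rewrite inE.
  by rewrite dx.
have /rV0Pn[i0 vi0] := v0.
have di0 : (0 < deg G i0)%N by rewrite lt0n; apply: contra vi0 => /eqP/isolated->.
have [x dx xmax] := @arg_maxP _ _ _ i0 (fun i => (0 < deg G i)%N)
  (fun i => `|v ord0 i| / d i) di0.
exists x; split=> //.
set t := `|v ord0 x| / d x in xmax.
have dR i : (0 < deg G i)%N -> 0 < d i by rewrite /d ltr0n.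
have t0 : 0 < t.
  by apply: lt_le_trans (xmax i0 di0); rewrite divr_gt0 ?normr_gt0 // dR.
have le_t y : `|v ord0 y| <= t * d y.
  have [/isolated->|dy] := posnP (deg G y).
    by rewrite normr0 mulr_ge0 ?ler0n // ltW.
  by rewrite -ler_pdivrMr ?dR //; exact: xmax.
have vx : `|v ord0 x| = t * d x by rewrite /t divfK // gt_eqF ?dR.
have : r * (t * d x) <= t * d x * d x + \sum_(y | G x y) t * d y.
  rewrite -vx -{1}(gtr0_norm r0) -normrM entry.
  apply: (le_trans (ler_normD _ _)); apply: lerD.
    by rewrite normrM (gtr0_norm (dR x dx)).
  by apply: (le_trans (ler_norm_sum _ _ _)); apply: ler_sum => y _.
rewrite -mulr_sumr mulrCA -[t * d x * d x]mulrA -mulrDr ler_pM2l //.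
by rewrite natrD natrX natr_sum expr2.
Qed.

Local Close Scope ring_scope.

Lemma even_double_sum {n : nat} (f : 'I_n -> 'I_n -> nat) :
  (forall x y, f x y = f y x) -> (forall x, f x x = 0) ->
  ~~ odd (\sum_x \sum_y f x y).
Proof.
move=> fC f0.
have -> : \sum_x \sum_y f x y = \sum_(x < n) \sum_(y < n | x < y) f x y +
      \sum_(x < n) \sum_(y < n | y < x) f x y.
  rewrite -big_split; apply: eq_bigr => x _; rewrite (bigID (fun y : 'I_n => x < y)) /=.
  congr (_ + _); rewrite (bigD1 x) ?ltnn //= f0; apply: eq_bigl => y.
  by rewrite -val_eqE /=; lia.
rewrite [X in _ + X](exchange_big_dep xpredT) //=.
under [X in _ + X]eq_bigr do under eq_bigr do rewrite fC.
by rewrite addnn odd_double.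
Qed.

Lemma sum_nbrs_non_nbrs {n : nat} (G : rel 'I_n) (x : 'I_n) (F : 'I_n -> nat) :
  simple_graph G ->
  \sum_y F y = F x + (\sum_(y | G x y) F y + \sum_(y | non_edge G x y) F y).
Proof.
move=> [_ Girr]; rewrite (bigD1 x) //= (bigID (G x)) /=; congr (_ + (_ + _)).
  apply: eq_bigl => y; have [->|//] := eqVneq y x; by rewrite Girr.
by apply: eq_bigl => y; rewrite /non_edge eq_sym.
Qed.

(** Both sides count ordered pairs. Let [d = deg x] and let [K] count the non-edges leaving
    neighbours of [x]. The degree bound becomes [K < d (d - n + 3)], so [x] has at most one
    non-neighbour, and the two cases bound the total through [K]. *)
Lemma few_non_edges (R : realType) (n : nat) (G : rel 'I_n) (r : R) :
  5 < n -> simple_graph G -> eigenvalue (signless_laplacian R G) r ->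
  ((2 * n)%:R - 4 < r)%R ->
  \sum_x \sum_y non_edge G x y <= 2 * (n - 2).
Proof.
move=> n5 SG eig rn; have [Gsym Girr] := SG.
have r0 : (0 < r)%R.
  apply: lt_trans rn; rewrite subr_gt0 ltr_nat; lia.
have [x [dx le_r]] := eigen_degree_bound R n G r SG eig r0.
have neC y z : non_edge G y z = non_edge G z y by rewrite /non_edge eq_sym Gsym.
have ne0 y : non_edge G y y = false by rewrite /non_edge eqxx.
have degE y : deg G y = \sum_(z | G y z) 1.
  by rewrite /deg -sum1_card; apply: eq_bigl => z; rewrite inE.
pose cd y := \sum_z non_edge G y z.
have cdE y : cd y = \sum_(z | non_edge G y z) 1.
  by rewrite /cd [RHS]big_mkcond; apply: eq_bigr => z _; case: non_edge.
have deg_cd y : deg G y + cd y + 1 = n.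
  rewrite degE cdE -[RHS]card_ord -sum1_card (sum_nbrs_non_nbrs G y) //; lia.
set K := \sum_(y | G x y) cd y.
set D := \sum_(y | G x y) deg G y in le_r.
have DK : D + K + deg G x = n * deg G x.
  rewrite {1}degE -!big_split /= degE big_distrr /=.
  by apply: eq_bigr => y _; rewrite deg_cd muln1.
have bound : (2 * n - 4) * deg G x < deg G x ^ 2 + D.
  rewrite -(ltr_nat R); apply: lt_le_trans le_r.
  by rewrite natrM ltr_pM2r ?ltr0n // natrB //; lia.
have dcx := deg_cd x.
have K_lt : K + (2 * n - 4) * deg G x < deg G x * (deg G x + n - 1).
  move: bound DK; rewrite expnS expn1; move: (deg G x) dx => d dpos.
  by rewrite -addnBA ?(ltn_trans _ n5) // mulnDr mulnBr muln1 (mulnC d n); nia.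
have cx2 : cd x < 2.
  rewrite ltnNge; apply/negP => cx.
  have : deg G x * (deg G x + n - 1) <= deg G x * (2 * n - 4).
    by rewrite leq_mul2l; lia.
  by rewrite [X in _ <= X]mulnC; lia.
have tot : \sum_y \sum_z non_edge G y z = cd x + (K + \sum_(y | non_edge G x y) cd y).
  exact: sum_nbrs_non_nbrs.
have [cx0|cx1] : cd x = 0 \/ cd x = 1 by lia.
  have none y : non_edge G x y = false.
    by apply/negP => xy; move: cx0; rewrite /cd (bigD1 y) //= xy.
  (* The counting bound is [2n - 3]; the sum over ordered pairs is even. *)
  have ev := even_double_sum (fun y z => non_edge G y z : nat)
    (fun y z => congr1 nat_of_bool (neC y z)) (fun y => congr1 nat_of_bool (ne0 y)).
  move: ev; rewrite tot big_pred0 // cx0 add0n addn0.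
  have dn : deg G x = n.-1 by lia.
  have : K < 2 * n.-1 by move: K_lt; rewrite dn; clear -n5; nia.
  by clear -n5; lia.
have [z0 z0P] : {z0 | [pred z | non_edge G x z] =i pred1 z0}.
  by apply: mem_card1; rewrite -cx1 cdE sum1_card.
have z0E z : non_edge G x z = (z == z0) by have := z0P z; rewrite !inE.
(* Apart from [x], the non-neighbours of [z0] are neighbours of [x], each of which contributes its
   non-edge to [z0] to [K]. *)
have cz0 : cd z0 <= 1 + K.
  rewrite /cd (sum_nbrs_non_nbrs G x) // (eq_bigl _ _ z0E) big_pred1_eq ne0 addn0.
  rewrite leq_add ?leq_b1 //; apply: leq_sum => p _.
  by rewrite /cd (bigD1 z0) //= neC leq_addr.
rewrite tot cx1 (eq_bigl _ _ z0E) big_pred1_eq.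
have dn : deg G x = n - 2 by lia.
have : K < n - 2 by move: K_lt; rewrite dn; clear -n5; nia.
by clear -n5 cz0; lia.
Qed.

(** * The exceptional graph *)

Lemma clique_pendant_last {n : nat} (x y : 'I_n) :
  x.+1 = n -> clique_pendant n x y -> y = 0 :> nat.
Proof.
move=> xn; rewrite /clique_pendant xn ltnn /= eqxx andbT.
case/andP=> xy /orP[/andP[_ /eqP yn]|/eqP //].
by move: xy; rewrite -val_eqE /=; lia.
Qed.

(** All edges of the cycle lie in one graph, whose pendant vertex would need two distinct
    neighbours, its predecessor and its successor. *)
Lemma clique_pendant_no_rainbow {n : nat} (G : 'I_n -> rel 'I_n) :
  2 < n -> (forall i, simple_graph (G i)) -> (forall i j, G i =2 G j) ->
  (forall i, graph_iso (G i) (clique_pendant n)) -> ~ rainbow_ham_cycle G.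
Proof.
move=> n2 SG eqG iso [v [c H]].
have n0 : 0 < n by lia.
pose i0 := Ordinal n0.
have lt1 : n.-1 < n by lia.
pose l := Ordinal lt1.
have [s sP] := iso i0.
have H' k : G i0 (v k) (v (ordS k)) by rewrite (eqG i0 (c k)).
pose k := (v^-1 (s^-1 l))%g.
have vk : s (v k) = l by rewrite /k !permKV.
have end_ y : G i0 (v k) y -> s y = 0 :> nat.
  by rewrite sP vk; apply: clique_pendant_last; rewrite /= prednK.
have e1 := end_ _ (H' k).
have e2 : s (v (ord_pred k)) = 0 :> nat.
  by apply: end_; rewrite (proj1 (SG i0)) -{2}(ord_predK k).
have := ordSS_neq (ord_pred k) n2; rewrite ord_predK.
by have /perm_inj/perm_inj-> := ord_inj (etrans e1 (esym e2)); rewrite eqxx.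
Qed.

Lemma clique_pendant_iso {n : nat} (G : rel 'I_n) (x z : 'I_n) :
  x != z -> (forall p q, G p q = (p != q) && ~~ star_but x z p q) ->
  graph_iso G (clique_pendant n).
Proof.
move=> xz GE.
have n1 : 1 < n.
  by have := ltn_ord x; have := ltn_ord z; move: xz; rewrite -val_eqE /=; lia.
have lt0 : 0 < n by lia.
have lt1 : n.-1 < n by lia.
pose o := Ordinal lt0; pose l := Ordinal lt1.
have lo : l != o by rewrite -val_eqE /=; lia.
(* The first transposition takes [x] to the pendant vertex [l]; the second takes the image of [z] to
   [o] and fixes [l]. *)
pose s := (tperm x l * tperm (tperm x l z) o)%g.
have sx : s x = l.
  rewrite /s permM tpermL tpermD // ?(eq_sym o) //.
  by rewrite -{2}(tpermL x l) (inj_eq perm_inj) eq_sym.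
have sz : s z = o by rewrite /s permM tpermL.
have s_last p : ((s p).+1 == n) = (p == x).
  by rewrite -(inj_eq (@perm_inj _ s)) sx -val_eqE /=; lia.
have s_lt p : ((s p).+1 < n) = (p != x).
  by rewrite -s_last ltn_neqAle ltn_ord andbT.
have s0 p : (s p == 0 :> nat) = (p == z).
  by rewrite -(inj_eq (@perm_inj _ s)) sz -val_eqE.
exists s => p q; rewrite GE /clique_pendant /star_but (inj_eq perm_inj).
rewrite !s_last !s_lt !s0.
have [//|pq] /= := eqVneq p q.
have [px|px] := eqVneq p x; have [qx|qx] := eqVneq q x => //=.
- by rewrite px qx eqxx in pq.
- by rewrite px (negPf xz) orbF negbK andbT.
- by rewrite qx (negPf xz) andbT orbF negbK.
Qed.

(** * Combining the weights with the matching *)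

Lemma rainbow_or_clique_pendant {n : nat} (G : 'I_n -> rel 'I_n) :
  5 < n -> (forall i, simple_graph (G i)) ->
  (forall i, \sum_x \sum_y non_edge (G i) x y <= 2 * (n - 2)) ->
  rainbow_ham_cycle G \/
  (forall i j, G i =2 G j) /\ (forall i, graph_iso (G i) (clique_pendant n)).
Proof.
move=> n5 SG few.
have [/existsP[v /existsP[c /forallP H]]|none] :=
  boolP [exists v : {perm 'I_n}, exists c : {perm 'I_n},
    forall k, G (c k) (v k) (v (ordS k))]; first by left; exists v, c.
right.
pose w x y := \sum_i non_edge (G i) x y.
have neC i x y : non_edge (G i) x y = non_edge (G i) y x.
  by rewrite /non_edge eq_sym (proj1 (SG i)).
have wC x y : w x y = w y x by apply: eq_bigr => i _; rewrite neC.
have w0 x : w x x = 0 by rewrite /w big1 // => i _; rewrite /non_edge eqxx.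
have wn x y : w x y <= n.
  rewrite -[leqRHS]card_ord -sum1_card; apply: leq_sum => i _; exact: leq_b1.
have w_full x y : n <= w x y -> forall i, non_edge (G i) x y.
  move=> nw i; apply: contraLR nw => ni; rewrite -ltnNge.
  rewrite -[ltnRHS]card_ord -sum1_card /w (bigD1 i) //= (negPf ni).
  rewrite [ltnRHS](bigD1 i) //= add0n add1n ltnS.
  by apply: leq_sum => j _; exact: leq_b1.
have w_none x y : w x y = 0 -> forall i, ~~ non_edge (G i) x y.
  move=> wxy i; apply/negP => ni; move: wxy.
  by rewrite /w (bigD1 i) //= ni.
have total : \sum_x \sum_y w x y <= 2 * (n * (n - 2)).
  have -> : \sum_x \sum_y w x y = \sum_i \sum_x \sum_y non_edge (G i) x y.
    rewrite [RHS]exchange_big; apply: eq_bigr => x _.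
    by rewrite [RHS]exchange_big.
  apply: (@leq_trans (\sum_(i < n) 2 * (n - 2))); first exact: leq_sum.
  by rewrite sum_nat_const card_ord mulnCA.
have neq_next (v : {perm 'I_n}) k : v k != v (ordS k).
  by rewrite (inj_eq perm_inj) eq_sym ordS_neq //; lia.
(* The weight of [v] counts the bad pairs of a position and a graph. Without a dead edge no row is
   full, so a matching would yield a rainbow cycle. *)
have dead v : tour_sum w v < 2 * n - 2 -> exists k, n <= w (v k) (v (ordS k)).
  move=> vW; apply/existsP; apply: contraNT none => /existsPn alive.
  have [k|g|c cP] := matching_of_few_bad
    (fun k g => non_edge (G g) (v k) (v (ordS k))) vW.
  - have := alive k; rewrite -ltnNge => lt.
    apply/existsP; apply: contraLR lt => /existsPn full; rewrite -leqNgt.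
    rewrite -[leqLHS]card_ord -sum1_card; apply: leq_sum => i _.
    by have := full i; rewrite negbK => ->.
  (* A full column is a graph missing the whole cycle: two non-edges at every vertex, [2n] ordered
     pairs, more than [2 (n - 2)]. *)
  - apply/existsP; have := few g; apply: contraLR => /existsPn full.
    rewrite -ltnNge; apply: (@leq_trans (\sum_(x < n) 2)).
      by rewrite sum_nat_const card_ord; lia.
    apply: leq_sum => x _.
    have nxt k : non_edge (G g) (v k) (v (ordS k)) by have := full k; rewrite negbK.
    pose k := (v^-1 x)%g; have vk : v k = x by rewrite permKV.
    rewrite (bigD1 (v (ordS k))) //= (bigD1 (v (ord_pred k))) /=; last first.
      rewrite (inj_eq perm_inj) -{2}(ord_predK k) eq_sym ordSS_neq //; lia.
    by rewrite -{1}vk nxt neC -vk -{2}(ord_predK k) nxt.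
  apply/existsP; exists v; apply/existsP; exists c; apply/forallP => k.
  by have := cP k; rewrite /non_edge neq_next /= negbK.
have [x [z [xz wE]]] := star_of_dead_tours w n5 wC w0 wn total dead.
(* Weight [n] means missing from every graph and weight [0] from none, so the weights determine each
   [G i]. *)
have GE i p q : G i p q = (p != q) && ~~ star_but x z p q.
  have [->|pq] := eqVneq p q; first exact: (proj2 (SG i)).
  have := wE p q; case: ifP => _ Ew.
    by have := w_full p q; rewrite Ew leqnn => /(_ isT i); rewrite /non_edge pq => /negPf.
  by have := w_none p q Ew i; rewrite /non_edge pq negbK.
split=> [i j p q|i]; first by rewrite !GE.
exact: clique_pendant_iso (GE i).
Qed.

Local Open Scope ring_scope.

Theorem mainTheorem3 (R : realType) (n : nat) (G : 'I_n -> rel 'I_n) :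
  (6 <= n)%N ->
  (forall i, simple_graph (G i)) ->
  (forall i, exists r : R,
      is_largest_eigenvalue (signless_laplacian R (G i)) r /\
      (2 * n)%:R - 4 < r) ->
  (rainbow_ham_cycle G <->
   ~ ((forall i j, G i =2 G j) /\ (forall i, graph_iso (G i) (clique_pendant n)))).
Proof.
move=> n5 SG spec; split=> [rainbow [eqG iso]|not_exc].
  by apply: clique_pendant_no_rainbow rainbow => //; apply: leq_trans n5.
have few i : (\sum_x \sum_y non_edge (G i) x y <= 2 * (n - 2))%N.
  by have [r [[eig _] rn]] := spec i; exact: few_non_edges R n (G i) r n5 (SG i) eig rn.
by have [//|/not_exc] := rainbow_or_clique_pendant G n5 SG few.
Qed.
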